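(* Let $n\in\mathbb{N}$. Then there exist a square-free integer $D>1$ and $d\in\mathbb{N}$ such that there are at least $n$ non-equivalent, additively indecomposable binary quadratic forms of determinant $d$ over $\mathcal{O}_{\mathbb{Q}(\sqrt{D})}$.
   Context: $\mathcal{O}_K$ denotes the ring of integers of $K=\mathbb{Q}(\sqrt{D})$. A binary quadratic form over $\mathcal{O}_K$ is $Q(x,y)=ax^2+bxy+cy^2$ with $a,b,c\in\mathcal{O}_K$; its Gram matrix is $M_Q=\begin{pmatrix} a & b/2 \\ b/2 & c \end{pmatrix}$ and its determinant is $\det(Q)=\det(M_Q)=ac-\frac{b^2}{4}$. For $\alpha\in K$, $\alpha\succeq 0$ means $\sigma(\alpha)\geq0$ for every embedding $\sigma:K\to\mathbb{R}$. $Q$ is totally positive semi-definite if $Q(v)\succeq0$ for all $v\in K^2$, and totally positive definite if moreover $Q(v)=0$ implies $v=0$. A totally positive definite binary form $Q$ over $\mathcal{O}_K$ is additively indecomposable if it cannot be written as $Q=Q_1+Q_2$ with $Q_1,Q_2$ nonzero totally positive semi-definite binary quadratic forms over $\mathcal{O}_K$. Two forms $Q,H$ are equivalent if $M_H=NM_QN^t$ for some $N\in\mathcal{O}_K^{2\times2}$ with $\det N\in\mathcal{O}_K^\times$. *)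

(* Defs.v *)
From HB Require Import structures.
From mathcomp Require Import all_boot all_order all_algebra all_field.
From mathcomp Require Import reals.

Set Implicit Arguments.
Unset Strict Implicit.
Unset Printing Implicit Defensive.

Import Order.TTheory GRing.Theory Num.Theory.

Local Open Scope ring_scope.

Definition squarefree (D : int) : Prop :=
  forall m : int, (m ^+ 2 %| D)%Z -> m \is a GRing.unit.

(* [subFExtend iota z p] is the field generated by [z] over the image of
   [iota], provided that [p] is a nonzero polynomial which has [z] as a root
   under [iota]; this is the case here for every [D]. *)
Definition quadratic_field (D : int) : fieldType :=
  subFExtend (ratr : {rmorphism rat -> algC}) (sqrtC D%:~R) ('X^2 - D%:~R%:P).

Definition alg_integer (K : fieldType) (x : K) : Prop :=
  integralOver (intr : int -> K) x.

Definition alg_integer_unit (K : fieldType) (x : K) : Prop :=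
  alg_integer x /\ exists y : K, alg_integer y /\ x * y = 1.

Definition totally_nonneg (R : realType) (K : fieldType) (x : K) : Prop :=
  forall sigma : {rmorphism K -> R}, 0 <= sigma x.

(* [BQF a b c] is the form a x^2 + b x y + c y^2; the cross term is b,
   not 2 b. *)
Record bqf (K : fieldType) := BQF { qa : K; qb : K; qc : K }.

Section BinaryQuadraticForms.

Variables (R : realType) (K : fieldType).
Implicit Types Q H : bqf K.

Definition integral_form Q : Prop :=
  [/\ alg_integer (qa Q), alg_integer (qb Q) & alg_integer (qc Q)].

Definition bqf_eval Q (x y : K) : K :=
  qa Q * x ^+ 2 + qb Q * x * y + qc Q * y ^+ 2.

Definition bqf_zero : bqf K := BQF 0 0 0.

Definition bqf_add Q H : bqf K :=
  BQF (qa Q + qa H) (qb Q + qb H) (qc Q + qc H).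

Definition gram Q : 'M[K]_2 :=
  \matrix_(i < 2, j < 2)
    if i == j then (if i == 0 then qa Q else qc Q) else qb Q / 2.

Definition bqf_det Q : K := \det (gram Q).

Definition totally_psd Q : Prop :=
  forall x y : K, totally_nonneg R (bqf_eval Q x y).

Definition totally_pd Q : Prop :=
  totally_psd Q /\
  forall x y : K, bqf_eval Q x y = 0 -> x = 0 /\ y = 0.

Definition additively_indecomposable Q : Prop :=
  ~ exists Q1 Q2 : bqf K,
      [/\ integral_form Q1, totally_psd Q1 & Q1 <> bqf_zero] /\
      [/\ integral_form Q2, totally_psd Q2 & Q2 <> bqf_zero] /\
      Q = bqf_add Q1 Q2.

Definition bqf_equiv Q H : Prop :=
  exists N : 'M[K]_2,
    [/\ forall i j, alg_integer (N i j),
        alg_integer_unit (\det N)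
      & gram H = N *m gram Q *m N^T].

End BinaryQuadraticForms.

(* Main.v *)
Require Import Defs.
From HB Require Import structures.
From mathcomp Require Import all_boot all_order all_algebra all_field.
From mathcomp Require Import reals.
From mathcomp Require Import zify ring lra.

(** Take t odd with D = t^2 + 1 square-free; then D = 2 mod 4, so the ring of
    integers of K = Q(sqrt D) is Z[sqrt D].  The linear functional
    l(x + y sqrt D) = x - t y is integer valued on it and, because t < sqrt D,
    positive on every nonzero totally nonnegative element.  Hence an integer a
    with l(a) = 1 is never a sum of two nonzero totally nonnegative integers.

    Let Q be a totally positive form of determinant d with such a first
    coefficient a.  In a decomposition Q = Q1 + Q2 one summand, say Q1, has
    first coefficient 0, and semi-definiteness leaves only Q1 = c' y^2.  The
    determinant of Q2 is then d - a c', so a c' is at most d in both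
    embeddings; taking norms, N(a) <= N(a) N(c') <= d^2.  Thus Q is additively
    indecomposable as soon as N(a) > d^2
    ([additively_indecomposable_of_norm]).

    Suitable a come from Pythagorean triples: if t^2 = z^2 + w^2, then
    a = (D + t z) + (t + z) sqrt D, the unit t + sqrt D times z + sqrt D, has
    l(a) = 1 and norm w^2 + 1.  With a' the conjugate of a, the form
    a x^2 + 2 m w x y + m^2 a' y^2 has determinant m^2.  All its values satisfy
    N(Q(x, y)) = N(a) N(x)^2 mod m, so gcd(m, w^2 + 1) is an invariant of the
    equivalence class ([family_equiv_dvd]).

    It remains to choose the numbers ([exists_parameters]): t = W u where W is
    the hypotenuse of n triples with legs z_i, w_i, the number m is a product
    of g_i = 1 + u0^2 w_i^2 with u0 the product of the z_i, and u = u0 mod 2 m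
    is large.  Then gcd(m, (u w_i)^2 + 1) = g_i, which are pairwise distinct.
    This confines t to an arithmetic progression, on which t^2 + 1 must still be
    made square-free.  That is a sieve ([exists_sqr_add1_squarefree]): an odd
    prime p has at most two square roots of -1 modulo p^2, so p^2 divides
    t^2 + 1 for at most 2 (V / p^2 + 1) of the first V terms; the main terms
    add up to at most 4 V / 5, and the error term is twice the number of primes
    up to a constant times V, which is o(V) by Chebyshev's bound. *)

Import Order.TTheory GRing.Theory Num.Theory.

Set Implicit Arguments.
Unset Strict Implicit.
Unset Printing Implicit Defensive.

(** * Chebyshev's upper bound for the number of primes *)

Definition prime_pi (N : nat) : nat := \sum_(0 <= p < N.+1 | prime p) 1.

Lemma prod_primes_dvd (s : seq nat) (N : nat) :
  uniq s -> all prime s -> all (dvdn^~ N) s -> \prod_(p <- s) p %| N.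
Proof.
elim: s => [|p s IHs] /=; first by rewrite big_nil dvd1n.
case/andP=> ps us /andP[pp prs] /andP[pN dN].
rewrite big_cons Gauss_dvd ?pN ?IHs // prime_coprime //.
rewrite big_seq; elim/big_ind: _ => [|x y Nx Ny|q qs].
- by rewrite Euclid_dvd1.
- by rewrite Euclid_dvdM // negb_or Nx.
- rewrite dvdn_prime2 ?(allP prs q qs) //.
  by apply: contra ps => /eqP->.
Qed.

Lemma leq_bin_expn (n k : nat) : 'C(n, k) <= 2 ^ n.
Proof.
case: (leqP k n) => [kn|/bin_small-> //].
rewrite (expnDn 1 1) (bigD1 (Ordinal (kn : k < n.+1))) //=.
by rewrite !exp1n !muln1 leq_addr.
Qed.

(** The primes in (n, 2n] all exceed n and all divide the central binomial
    coefficient, which is at most 4^n. *)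
Lemma expn_prime_pi_diff (n : nat) :
  n ^ (prime_pi n.*2 - prime_pi n) <= 2 ^ n.*2.
Proof.
pose s := [seq p <- index_iota n.+1 n.*2.+1 | prime p].
have -> : prime_pi n.*2 - prime_pi n = size s.
  rewrite /prime_pi (@big_cat_nat _ _ _ n.+1 0 n.*2.+1) //=; last by lia.
  by rewrite addnC addnK size_filter -sum1_count.
have in_s p : p \in s -> [/\ prime p, n < p & p <= n.*2].
  by rewrite mem_filter mem_index_iota => /andP[-> /andP[-> ]].
apply: (@leq_trans (\prod_(p <- s) p)).
  elim: s in_s => [|p s IHs] in_s; first by rewrite big_nil.
  rewrite big_cons /= expnS leq_mul //.
    by have [_ /ltnW] := in_s p (mem_head _ _).
  by apply: IHs => q qs; apply: in_s; rewrite in_cons qs orbT.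
apply: leq_trans (leq_bin_expn n.*2 n).
apply: dvdn_leq; first by rewrite bin_gt0; lia.
apply: prod_primes_dvd.
- by rewrite filter_uniq ?iota_uniq.
- by apply/allP => p /in_s[].
apply/allP => p /in_s[pp np p2n].
have: p %| (n.*2)`! by rewrite dvdn_fact // p2n prime_gt0.
rewrite -(@bin_fact n.*2 n); last by lia.
have -> : n.*2 - n = n by lia.
have Npn : ~~ (p %| n`!).
  elim: n np {in_s s p2n} => [|n IHn] np; first by rewrite Euclid_dvd1.
  by rewrite factS Euclid_dvdM // negb_or gtnNdvd // IHn // ltnW.
by rewrite !Euclid_dvdM // (negPf Npn) !orbF.
Qed.

(** Chebyshev's bound at powers of 2, where the dyadic estimate can be summed by
    induction; the inductive step needs K >= 3, whence the explicit base. *)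
Lemma prime_pi_expn2 (K : nat) : K * prime_pi (2 ^ K) <= 2 ^ K.+2.
Proof.
have base : [&& prime_pi (2 ^ 1) == 1, prime_pi (2 ^ 2) == 2 &
             prime_pi (2 ^ 3) == 4].
  by rewrite /prime_pi unlock.
have [b1 b2 b3] := and3P base.
case: K => [|[|[|K]]] //; rewrite ?(eqP b1) ?(eqP b2) //.
elim: K => [|K IHK]; first by rewrite (eqP b3).
set k := K.+3 in IHK *.
have := expn_prime_pi_diff (2 ^ k).
rewrite -mul2n -expnS -expnM leq_exp2l // => Hd.
have : 6 * (2 ^ k) >= k * prime_pi (2 ^ k.+1).
  move: IHK Hd; rewrite !expnS; nia.
rewrite !expnS; rewrite /k; nia.
Qed.

(** * Square-free values of t^2 + 1 in arithmetic progressions *)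

Lemma count_one_class (P : pred nat) (V e : nat) :
  0 < e -> (forall x y, P x -> P y -> x = y %[mod e]) ->
  count P (iota 0 V) <= (V %/ e).+1.
Proof.
move=> e_gt0 Pe; rewrite -size_filter -(size_map (divn^~ e)).
rewrite -(size_iota 0 (V %/ e).+1); apply: uniq_leq_size.
  rewrite map_inj_in_uniq ?filter_uniq ?iota_uniq // => x y.
  rewrite !mem_filter => /andP[Px _] /andP[Py _] exy.
  by rewrite (divn_eq x e) exy (Pe _ _ Px Py) -divn_eq.
move=> q /mapP[x]; rewrite mem_filter !mem_iota !add0n /= => /andP[_ xV] ->.
by rewrite ltnS leq_div2r // ltnW.
Qed.

Lemma modn_affine_inj (e M t x y : nat) :
  coprime e M -> t + M * x = t + M * y %[mod e] -> x = y %[mod e].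
Proof.
move=> eM; wlog xy : x y / x <= y.
  by move=> H; case: (leqP x y) => [/H//|/ltnW/H{}H /esym/H].
move/esym/eqP; rewrite eqn_mod_dvd ?leq_add2l ?leq_mul2l ?xy ?orbT //.
rewrite subnDl -mulnBr Gauss_dvdr // => exy.
by apply/esym/eqP; rewrite eqn_mod_dvd.
Qed.

(** There are at most two square roots of -1 modulo p^2: p cannot divide both
    x - y and x + y, for it would then divide 2 x, hence x, hence 1. *)
Lemma dvdn_sqr_split (p x y : nat) :
  prime p -> odd p -> p ^ 2 %| x ^ 2 + 1 -> p ^ 2 %| y ^ 2 + 1 ->
  x = y %[mod p ^ 2] \/ p ^ 2 %| x + y.
Proof.
move=> pp po; wlog xy : x y / y <= x.
  move=> H dx dy; case: (leqP y x) => [/H/(_ dx dy)//|/ltnW/H/(_ dy dx)].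
  by rewrite addnC => -[->|]; [left|right].
move=> dx dy.
have : p ^ 2 %| (x - y) * (x + y).
  by rewrite -subn_sqr -(subnDr 1) dvdn_sub.
have [pxy|pxy] := boolP (p %| x + y).
  rewrite Gauss_dvdr ?coprimeXl ?prime_coprime //; first by right.
  apply/negP => pxy'.
  have p2x : p %| 2 * x.
    by have -> : 2 * x = (x + y) + (x - y); [lia | rewrite dvdn_add].
  have px : p %| x.
    move: p2x; rewrite Euclid_dvdM // => /orP[|//].
    by rewrite dvdn_prime2 // => /eqP pE; rewrite pE in po.
  have : p %| x ^ 2 + 1 by apply: dvdn_trans dx; rewrite dvdn_exp.
  by rewrite dvdn_addr ?Euclid_dvd1 // dvdn_exp.
rewrite Gauss_dvdl ?coprimeXl ?prime_coprime // => d.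
by left; apply/eqP; rewrite eqn_mod_dvd.
Qed.

Lemma count_sqr_add1 (p M t V : nat) :
  prime p -> odd p -> coprime p M ->
  count (fun v => p ^ 2 %| (t + M * v) ^ 2 + 1) (iota 0 V)
    <= 2 * (V %/ p ^ 2).+1.
Proof.
move=> pp po pM; set P := fun v => _.
have p2 : 0 < p ^ 2 by rewrite expn_gt0 prime_gt0.
have cop : coprime (p ^ 2) M by rewrite coprimeXl.
have [/hasP[v1 _ Pv1]|] := boolP (has P (iota 0 V)); last first.
  by rewrite has_count -leqNgt leqn0 => /eqP->.
pose A v := t + M * v == t + M * v1 %[mod p ^ 2].
pose B v := p ^ 2 %| (t + M * v) + (t + M * v1).
apply: (@leq_trans (count A (iota 0 V) + count B (iota 0 V))).
  rewrite -count_predUI; apply: leq_trans (leq_addr _ _).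
  apply: sub_count => v Pv /=; apply/orP.
  by have [/eqP|] := dvdn_sqr_split pp po Pv Pv1; [left|right].
rewrite mul2n -addnn leq_add ?count_one_class // => x y.
  by move=> /eqP Ax /eqP Ay; apply: (modn_affine_inj (t := t) cop); rewrite Ax Ay.
move=> Bx By; apply: (modn_affine_inj (t := t) cop); apply/eqP.
rewrite -(eqn_modDr (t + M * v1)).
by move: Bx By; rewrite /B /dvdn => /eqP-> /eqP->.
Qed.

(** The bound 1 / p^2 < 4 / (4 p^2 - 1) = 2 / (2 p - 1) - 2 / (2 p + 1) makes
    the sum telescope from p = 3 on, to at most 2 / 5. *)
Lemma sum_inv_sqr (V N : nat) :
  5 * \sum_(3 <= p < N) V %/ p ^ 2 <= 2 * V.
Proof.
have [N3|N3] := ltnP N 3; first by rewrite big_geq // ltnW.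
have H : (\sum_(3 <= p < N) (V %/ p ^ 2)%:R <=
          V%:R * (2 / 5 - 2 / (2 * N%:R - 1)) :> rat)%R.
  elim: N N3 => // N IHN; rewrite leq_eqVlt => /orP[/eqP<-|N3].
    by rewrite big_geq // [X in (_ <= _ * X)%R](_ : _ = 0%R) ?mulr0 //.
  rewrite big_nat_recr //=.
  have {}IHN := IHN N3.
  have hN : (3 <= N%:R :> rat)%R by rewrite (ler_nat _ 3 N).
  have h1 : ((V %/ N ^ 2)%:R <= V%:R / N%:R ^+ 2 :> rat)%R.
    rewrite ler_pdivlMr; last by nra.
    by rewrite -natrX -natrM ler_nat leq_trunc_div.
  have h2 : (N%:R ^- 2 <= 2 / (2 * N%:R - 1) - 2 / (2 * N.+1%:R - 1) :> rat)%R.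
    rewrite -(natr1 N).
    have -> : (2 / (2 * N%:R - 1) - 2 / (2 * (N%:R + 1) - 1) =
      (N%:R ^+ 2 - 4^-1)^-1 :> rat)%R.
      field; apply/and3P; split; apply/eqP; nra.
    rewrite lef_pV2 ?qualifE /=; nra.
  have V0 : (0 <= V%:R :> rat)%R by rewrite ler0n.
  have := ler_wpM2l V0 h2; nra.
have hN : (3 <= N%:R :> rat)%R by rewrite (ler_nat _ 3 N).
rewrite -(ler_nat rat) !natrM natr_sum.
have h3 : (0 <= V%:R * (2 / (2 * N%:R - 1)) :> rat)%R.
  by rewrite mulr_ge0 ?ler0n // divr_ge0; lra.
nra.
Qed.

(** The coprimality hypothesis excludes local obstructions at the primes of q,
    and t odd makes the values 2 mod 4, so only odd primes p prime to the
    difference M of the progression are sieved.  If each of the first V terms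
    had a square factor p^2, counting would give V <= 4 V / 5 + 2 prime_pi X,
    where X bounds the numbers t + M v. *)
Lemma exists_sqr_add1_squarefree (t q : nat) :
  odd t -> odd q -> coprime q (t ^ 2 + 1) ->
  exists v, forall p, prime p -> ~~ (p ^ 2 %| (t + 2 * q * v) ^ 2 + 1).
Proof.
move=> ot oq cqt; set M := 2 * q.
have M0 : 0 < M by rewrite muln_gt0 /= odd_gt0.
(* The primes to sieve are at most X = 2^K.  From V <= 10 prime_pi X and
   K prime_pi X <= 4 X one gets K V <= 40 * 2^e V, refuted by K >= 64 * 2^e. *)
have [e Me] : exists e, M.+1 <= 2 ^ e.
  by exists M.+1; rewrite ltnW // ltn_expl.
have [K KE] : exists K, K = 2 ^ (e + 6) + t + e by exists (2 ^ (e + 6) + t + e).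
have [V VE] : exists V, V = 2 ^ (K - e) by exists (2 ^ (K - e)).
have Ke : 2 ^ (e + 6) + t = K - e by rewrite KE addnK.
have eK : e <= K by rewrite KE leq_addl.
have EV : 2 ^ K = 2 ^ e * V by rewrite VE -expnD subnKC.
pose c p := [&& prime p, odd p & coprime p M].
have big_t : t + M * V <= 2 ^ K.
  have tK : t <= V.
    by rewrite VE (leq_trans (ltnW (ltn_expl t (ltnSn 1)))) // leq_exp2l // -Ke leq_addl.
  rewrite EV.
  by apply: leq_trans (leq_mul Me (leqnn V)); rewrite mulSn; lia.
pose bad p v := p ^ 2 %| (t + M * v) ^ 2 + 1.
have [/hasP[v + /hasPn good]|] := boolP
    (has (fun v => ~~ has (fun p => c p && bad p v) (iota 0 (2 ^ K).+1))
      (iota 0 V)).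
  rewrite mem_iota add0n => /= vV; exists v => p pp; apply/negP => pf.
  have [T Tt To] : exists2 T, T = t + M * v & odd T.
    by exists (t + M * v); rewrite // /M -mulnA mul2n oddD odd_double addbF.
  rewrite -/M -Tt in pf.
  have po : odd p.
    apply/negPn/negP => /(prime_oddPn pp) p2; rewrite p2 in pf.
    by move: pf; rewrite -(odd_double_half T) To; lia.
  have pM : coprime p M.
    rewrite coprimeMr coprime_sym coprime2n po /= prime_coprime //.
    apply/negP => pq.
    have : p %| t ^ 2 + 1.
      have : p %| T ^ 2 + 1 by apply: dvdn_trans pf; rewrite dvdn_exp.
      have -> : T ^ 2 + 1 = t ^ 2 + 1 + q * (2 * v * (t + T)).
        by rewrite Tt /M; ring.
      by rewrite dvdn_addl // dvdn_mulr.
    move=> pt; have : p %| gcdn q (t ^ 2 + 1) by rewrite dvdn_gcd pq.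
    by rewrite (eqP cqt) Euclid_dvd1.
  (* from p^2 <= T^2 + 1, so that only primes up to X matter *)
  have pT : p <= T.
    have T0 : 0 < T by rewrite odd_gt0.
    have le_pT : p ^ 2 <= T ^ 2 + 1 by rewrite dvdn_leq // addn1.
    rewrite leqNgt; apply/negP => Tp.
    have : T.+1 ^ 2 <= p ^ 2 by rewrite leq_sqr.
    by rewrite -addn1 sqrnD; lia.
  suff /good : p \in iota 0 (2 ^ K).+1.
    by rewrite /c pp po pM /bad -Tt pf.
  rewrite mem_iota /= add0n ltnS (leq_trans pT) // Tt.
  by rewrite (leq_trans _ big_t) // leq_add2l leq_mul2l ltnW ?orbT.
rewrite -all_predC => /allP allbad; exfalso.
have le1 : V <= \sum_(0 <= p < (2 ^ K).+1 | c p) count (bad p) (iota 0 V).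
  under eq_bigr => p _ do rewrite -sum1_count.
  rewrite (exchange_big_dep predT) //= -{1}(size_iota 0 V) -sum1_size.
  rewrite big_seq [leqRHS]big_seq leq_sum // => v /allbad /negPn/hasP[p pK cbp].
  rewrite (big_rem p); last by rewrite /index_iota subn0.
  by have [cp bp] := andP cbp; rewrite /= cp bp leq_addr.
have le2 : V <= \sum_(0 <= p < (2 ^ K).+1 | c p) 2 * (V %/ p ^ 2).+1.
  apply: leq_trans le1 _; apply: leq_sum => p /and3P[pp po pM].
  exact: count_sqr_add1.
have le3 : \sum_(0 <= p < (2 ^ K).+1 | c p) 2 * (V %/ p ^ 2).+1 <=
  2 * \sum_(3 <= p < (2 ^ K).+1) V %/ p ^ 2 + 2 * prime_pi (2 ^ K).
  rewrite -big_distrr /= -mulnDr leq_mul2l /=.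
  under eq_bigr => p _ do rewrite -addn1.
  rewrite big_split /=; apply: leq_add; last first.
    rewrite /prime_pi big_mkcond [leqRHS]big_mkcond; apply: leq_sum => p _.
    by rewrite /c; case: (prime p) => //=; case: ifP.
  rewrite (@big_cat_nat _ _ _ 3) //=; last first.
    rewrite ltnS (leq_trans _ (ltn_expl K (ltnSn 1))) // ltnS KE.
    by have := ltn_expl (e + 6) (ltnSn 1); lia.
  rewrite big_nat_cond big1 => [|[|[|[|p]]]]; rewrite ?andbF //.
  by rewrite add0n big_mkcond; apply: leq_sum => p _; case: ifP.
have le4 := sum_inv_sqr V (2 ^ K).+1.
have le5 : V <= 10 * prime_pi (2 ^ K) by lia.
have le6 := prime_pi_expn2 K.
have : K * V <= 40 * 2 ^ K by move: le5 le6; rewrite !expnS; nia.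
rewrite EV mulnA leq_pmul2r ?VE ?expn_gt0 //.
rewrite KE expnD; have := expn_gt0 2 e; have -> : 2 ^ 6 = 64 by []. lia.
Qed.

(** * Choice of the parameters *)

Lemma odd_prod (I : finType) (F : I -> nat) :
  (forall i, odd (F i)) -> odd (\prod_i F i).
Proof. by move=> oF; elim/big_ind: _ => // x y; rewrite oddM => -> ->. Qed.

(** Each k gives the triple (k^2 - 1, 2 k, k^2 + 1); clearing denominators brings
    them to a common hypotenuse.  Only even k are used, so that W is odd. *)
Lemma common_hypotenuse (n : nat) :
  exists (W : nat) (z w : 'I_n -> nat),
    [/\ odd W, forall i, odd (z i), forall i, odd (w i) = false,
        injective w & forall i, 0 < w i /\ W ^ 2 = z i ^ 2 + w i ^ 2].
Proof.
pose k (i : 'I_n) := 2 * i.+1.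
pose s i := k i ^ 2 + 1.
pose W := \prod_i s i.
pose h i := W %/ s i.
have Wh i : W = h i * s i.
  by rewrite divnK // /W (bigD1 i) //= dvdn_mulr.
have so i : odd (s i) by rewrite /s /k oddD oddX oddM.
have oW : odd W by apply: odd_prod.
have ho i : odd (h i) by move: oW; rewrite (Wh i) oddM => /andP[].
have W0 : 0 < W by rewrite odd_gt0.
exists W, (fun i => (k i ^ 2 - 1) * h i), (fun i => 2 * k i * h i).
have k2 i : 1 < k i ^ 2 by rewrite /k; nia.
split=> // [i|i|i j|i].
- by rewrite oddM ho andbT oddB ?(ltnW (k2 i)) // /k expnMn oddM.
- by rewrite -mulnA oddM.
- move=> eq_w2; have eq_w : k i * h i = k j * h j.
    by move: (k i) (k j) (h i) (h j) eq_w2 => a b c d; lia.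
  have h0 l : 0 < h l by rewrite odd_gt0.
  have : k i * s j = k j * s i.
    apply/eqP; rewrite -(eqn_pmul2r (h0 i)) -(eqn_pmul2r (h0 j)).
    have -> : k i * s j * h i * h j = k i * h i * (h j * s j) by ring.
    rewrite eq_w -!Wh (Wh i); apply/eqP; ring.
  rewrite /s /k => eq_s; apply: val_inj => /=.
  move: (nat_of_ord i) (nat_of_ord j) eq_s => x y.
  wlog xy : x y / x <= y.
    by move=> H; case: (leqP x y) => [/H//|/ltnW/H{}H /esym/H].
  rewrite -(subnK xy); move: (y - x) => [//|e]; nia.
- split; first by rewrite /k !muln_gt0 /= odd_gt0.
  rewrite (Wh i) !expnMn -mulnDl mulnC; congr (_ * _).
  move: (k2 i); rewrite /s /k expnMn; move: (2 ^ 2 * _) => [|y _] //.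
  by rewrite subn1 /=; ring.
Qed.

(** Modulo a prime factor p of some g_i = 1 + (u0 w_i)^2, the number
    1 + (u0 W)^2 is (u0 z_i)^2, which is invertible because z_i divides u0 and p
    is prime to u0; modulo a prime factor of W it is 1.  So the progression of the t = W u with u = u0 mod 2 m has
    no local obstruction to square-free values.  Starting it at
    u1 = u0 + 2 m^3 ensures u >= m^2. *)
Lemma exists_parameters (n : nat) :
  exists (t m : nat) (z w : 'I_n -> nat),
    [/\ [/\ odd t, 0 < m & forall p, prime p -> ~~ (p ^ 2 %| t ^ 2 + 1)],
        forall i, t ^ 2 = z i ^ 2 + w i ^ 2,
        forall i, m ^ 4 < w i ^ 2 + 1
      & injective (fun i => gcdn m (w i ^ 2 + 1))].
Proof.
have [W [z [w [oW oz ew injw zw]]]] := common_hypotenuse n.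
pose u0 := \prod_i z i; pose g i := (u0 * w i) ^ 2 + 1; pose m := \prod_i g i.
have ou0 : odd u0 by apply: odd_prod.
have om : odd m by apply: odd_prod => i; rewrite /g oddD oddX oddM ew andbF.
have m0 := odd_gt0 om.
have dvdn_g i : g i %| m by rewrite /m (bigD1 i) //= dvdn_mulr.
pose u1 := u0 + 2 * m * m ^ 2.
have ou1 : odd u1 by rewrite /u1 -!mulnA oddD oddM addbF.
have cop : coprime (m * W) ((W * u1) ^ 2 + 1).
  rewrite coprimeMl; apply/andP; split; last first.
    have -> : (W * u1) ^ 2 = W * u1 ^ 2 * W by ring.
    by rewrite /coprime gcdnMDl gcdn1.
  rewrite /m; elim/big_ind: _ => [||i _]; first exact: coprime1n.
    by move=> x y xc yc; rewrite coprimeMl xc.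
  rewrite /coprime; apply/negPn/negP => ne1.
  have pp : prime (pdiv (gcdn (g i) ((W * u1) ^ 2 + 1))).
    by rewrite pdiv_prime // ltn_neqAle eq_sym ne1 gcdn_gt0 /g addn1.
  move: (pdiv _) pp (pdiv_dvd (gcdn (g i) ((W * u1) ^ 2 + 1))) => p pp.
  rewrite dvdn_gcd => /andP[pg].
  have [_ hW] := zw i.
  have -> : (W * u1) ^ 2 + 1 =
      (u0 * z i) ^ 2 + (g i + m * (2 * m ^ 2 * W ^ 2 * (u0 + u1))).
    by rewrite /u1 /g !expnMn hW; ring.
  rewrite dvdn_addl; last first.
    by rewrite dvdn_add // dvdn_mulr // (dvdn_trans pg) // dvdn_g.
  rewrite Euclid_dvdX // andbT Euclid_dvdM // => pu.
  have {}pu : p %| u0.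
    by case/orP: pu => // /dvdn_trans-> //; rewrite /u0 (bigD1 i) //= dvdn_mulr.
  by move: pg; rewrite /g dvdn_addr ?Euclid_dvd1 // dvdn_exp // dvdn_mulr.
have [||v sqf] := exists_sqr_add1_squarefree _ _ cop; try by rewrite oddM ?om ?oW.
pose u := u1 + 2 * m * v.
exists (W * u), m, (fun i => z i * u), (fun i => w i * u).
have tE : W * u1 + 2 * (m * W) * v = W * u by rewrite /u; ring.
have gE i : gcdn m ((w i * u) ^ 2 + 1) = g i.
  have -> : (w i * u) ^ 2 + 1 = (2 * m ^ 2 + 2 * v) * (u0 + u) * w i ^ 2 * m + g i.
    by rewrite /u /u1 /g; ring.
  by rewrite gcdnMDl; apply/gcdn_idPr.
split.
- split=> // [|p pp]; last by rewrite -tE sqf.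
  by rewrite oddM oW /u oddD ou1 -mulnA oddM.
- by move=> i; have [_ h] := zw i; rewrite !expnMn h mulnDl.
- move=> i; have [w0 _] := zw i.
  have le_u : m ^ 2 <= u.
    rewrite /u /u1 addnAC (leq_trans _ (leq_addl _ _)) // leq_pmull //.
    by rewrite muln_gt0.
  have : (m ^ 2) ^ 2 <= (w i * u) ^ 2.
    by rewrite leq_sqr (leq_trans le_u) // leq_pmull.
  by rewrite -expnM addn1 ltnS.
- move=> i j; rewrite !gE /g => /addIn/eqP; rewrite eqn_sqr eqn_pmul2l ?odd_gt0 //.
  by move/eqP/injw.
Qed.

Local Open Scope ring_scope.

(** * The quadratic field, its embeddings and its integers *)

(** The square of the denominator of q divides D, so that the denominator is a
    unit. *)
Lemma squarefree_mul_sqr_int (D : int) (q : rat) (k : int) :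
  squarefree D -> D%:~R * q ^+ 2 = k%:~R -> exists n : int, q = n%:~R.
Proof.
move=> sqD; have dn0 : (denq q)%:~R != 0 :> rat by rewrite intr_eq0 denq_neq0.
rewrite -{1}[q]divq_num_den exprMn exprVn mulrA => /(canRL (divfK _)).
rewrite expf_neq0 // => /(_ isT) /eqP; rewrite -!rmorphXn -!rmorphM eqr_int => /eqP e.
have /sqD u : (denq q ^+ 2 %| D)%Z.
  rewrite -(@Gauss_dvdzl _ _ (numq q ^+ 2)); first by rewrite e dvdz_mull.
  by rewrite coprimezXl // coprimezXr // coprimez_sym coprimezE coprime_num_den.
exists (numq q); rewrite -[LHS]divq_num_den.
suff -> : denq q = 1 by rewrite divr1.
by move: u (denq_gt0 q); rewrite qualifE /= => /orP[/eqP-> // | /eqP->].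
Qed.

Lemma squarefree_nonsquare (D : int) (q : rat) :
  1 < D -> squarefree D -> q ^+ 2 != D%:~R.
Proof.
move=> D1 sqD; apply/eqP => qD.
have D0 : D%:~R != 0 :> rat by rewrite intr_eq0; lia.
have [|n nE] := @squarefree_mul_sqr_int D (q / D%:~R) 1 sqD.
  by rewrite exprMn qD; field.
have : (D * n ^+ 2)%:~R = 1%:~R :> rat.
  by rewrite rmorphM rmorphXn /= -nE exprMn qD; field.
move/eqP; rewrite eqr_int => /eqP.
have [->|n0] := eqVneq n 0; first by rewrite expr0n mulr0.
have : 0 < n ^+ 2 by rewrite exprn_even_gt0.
nia.
Qed.

Section QuadraticField.

Variable D : int.
Hypotheses (D_gt1 : 1 < D) (sqfD : squarefree D).

Local Notation K := (quadratic_field D).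
Local Notation P := ('X^2 - D%:~R%:P : {poly rat}).

Let rt : algC := sqrtC D%:~R.

(** The class of a polynomial p, that is p(sqrt D). *)
Definition quad_eval : {poly rat} -> K :=
  subfx_eval (ratr : {rmorphism rat -> algC}) rt P.

HB.instance Definition _ := GRing.RMorphism.on quad_eval.

Definition quad_root : K := quad_eval 'X.

Lemma size_quad_poly : size P = 3%N.
Proof. by rewrite size_XnsubC. Qed.

Lemma quad_poly_neq0 : P != 0.
Proof. by rewrite -size_poly_eq0 size_quad_poly. Qed.

Lemma root_quad_poly : root (map_poly (ratr : {rmorphism rat -> algC}) P) rt.
Proof.
rewrite rmorphB /= map_polyXn map_polyC /= rootE !hornerE ratr_int.
by rewrite sqrtCK subrr.
Qed.

Lemma quad_inj_eval p :
  subfx_inj (quad_eval p) = (map_poly (ratr : {rmorphism rat -> algC}) p).[rt].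
Proof. exact: (subfx_inj_eval root_quad_poly quad_poly_neq0). Qed.

Lemma quad_eval_surj z : {p | z = quad_eval p}.
Proof. by apply: sig_eqW; apply: subfxE. Qed.

Lemma mod_quad_poly p : exists (q : {poly rat}) (a b : rat),
  p = q * P + (a%:P + b *: 'X).
Proof.
exists (p %/ P), (p %% P)`_0, (p %% P)`_1; rewrite {1}(divp_eq p P).
congr (_ + _); apply/polyP => i; rewrite coefD coefC coefZ coefX.
case: i => [|[|i]]; rewrite ?mulr0 ?mulr1 ?addr0 ?add0r //=.
have := ltn_modpN0 p quad_poly_neq0; rewrite size_quad_poly ltnS => sz.
by rewrite nth_default // (leq_trans sz).
Qed.

(** A polynomial vanishing at sqrt D is divisible by X^2 - D, since sqrt D is
    irrational; this makes evaluation at another root r well defined on K. *)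
Lemma quad_eval_eq0 (F : numFieldType) (r : F) (p : {poly rat}) :
  r ^+ 2 = D%:~R -> quad_eval p = 0 ->
  (map_poly (ratr : {rmorphism rat -> F}) p).[r] = 0.
Proof.
move=> rD p0.
have [q [a [b pE]]] := mod_quad_poly p.
have ev (L : numFieldType) (s : L) : s ^+ 2 = D%:~R ->
    (map_poly (ratr : {rmorphism rat -> L}) p).[s] = ratr a + ratr b * s.
  move=> sD; rewrite pE rmorphD rmorphM rmorphB rmorphD /= map_polyXn !map_polyC /=.
  by rewrite map_polyZ map_polyX /= ratr_int !hornerE /= sD subrr mulr0 add0r.
have := quad_inj_eval p; rewrite p0 rmorph0 (ev _ _ (sqrtCK _)) => /esym ab0.
have b0 : b = 0.
  apply/eqP/negPn/negP => b0; have rb : ratr b != 0 :> algC by rewrite fmorph_eq0.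
  have := squarefree_nonsquare (- a / b) D_gt1 sqfD.
  rewrite -(inj_eq (fmorph_inj (ratr : {rmorphism rat -> algC}))) /=.
  rewrite ratr_int -[X in _ != X]sqrtCK -/rt.
  have -> : rt = - ratr a / ratr b.
    by apply: (mulIf rb); rewrite divfK // -(addKr (ratr a) (rt * _)) mulrC ab0 addr0.
  by rewrite !rmorphXn fmorph_div rmorphN eqxx.
move: ab0; rewrite (ev _ _ rD) b0 !rmorph0 !mul0r !addr0 => /eqP.
by rewrite fmorph_eq0 => /eqP->; rewrite rmorph0.
Qed.

Lemma quad_embedding (F : numFieldType) (r : F) :
  r ^+ 2 = D%:~R -> exists sigma : {rmorphism K -> F}, sigma quad_root = r.
Proof.
move=> rD; pose ev p := (map_poly (ratr : {rmorphism rat -> F}) p).[r].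
pose s z := ev (sval (quad_eval_surj z)).
have sE p : s (quad_eval p) = ev p.
  rewrite /s; case: quad_eval_surj => q /= pq; apply/eqP.
  rewrite -subr_eq0 /ev -hornerN -hornerD -rmorphB /=; apply/eqP.
  by apply: quad_eval_eq0 => //; rewrite rmorphB /= pq subrr.
have s_zmod : zmod_morphism s.
  move=> x y; have [p ->] := quad_eval_surj x; have [q ->] := quad_eval_surj y.
  by rewrite -rmorphB !sE /ev rmorphB /= hornerD hornerN.
have s_mon : monoid_morphism s.
  split; first by rewrite -(rmorph1 quad_eval) sE /ev rmorph1 hornerC.
  move=> x y; have [p ->] := quad_eval_surj x; have [q ->] := quad_eval_surj y.
  by rewrite -rmorphM !sE /ev rmorphM /= hornerM.
pose S : {rmorphism K -> F} :=
  HB.pack s (GRing.isZmodMorphism.Build _ _ s s_zmod)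
    (GRing.isMonoidMorphism.Build _ _ s s_mon).
by exists S; rewrite /= /quad_root sE /ev map_polyX hornerX.
Qed.

Lemma quad_eval_poly : quad_eval P = 0.
Proof.
apply: (fmorph_inj (subfx_inj : {rmorphism K -> algC})) => /=.
by rewrite rmorph0 quad_inj_eval; apply/eqP/root_quad_poly.
Qed.

Lemma quad_root_sqr : quad_root ^+ 2 = D%:~R.
Proof.
apply/eqP; rewrite -subr_eq0 -(rmorph_int (quad_eval \o polyC)) /=.
by rewrite /quad_root -rmorphXn -rmorphB /= quad_eval_poly.
Qed.

Lemma quad_coord z : exists a b : rat, z = quad_eval (a%:P + b *: 'X).
Proof.
have [p ->] := quad_eval_surj z; have [q [a [b ->]]] := mod_quad_poly p.
by exists a, b; rewrite rmorphD rmorphM /= quad_eval_poly mulr0 add0r.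
Qed.

Lemma embedding_coord (F : numFieldType) (sigma : {rmorphism K -> F}) (a b : rat) :
  sigma (quad_eval (a%:P + b *: 'X)) = ratr a + ratr b * sigma quad_root.
Proof.
rewrite -mul_polyC !rmorphD !rmorphM /=; congr (_ + _ * _).
  exact: (fmorph_eq_rat (sigma \o quad_eval \o polyC)).
exact: (fmorph_eq_rat (sigma \o quad_eval \o polyC)).
Qed.

Lemma embedding_root_sqr (F : numFieldType) (sigma : {rmorphism K -> F}) :
  sigma quad_root ^+ 2 = D%:~R.
Proof. by rewrite -rmorphXn quad_root_sqr rmorph_int. Qed.

Lemma alg_integer_Aint (L : fieldType) (sigma : {rmorphism L -> algC}) (z : L) :
  alg_integer z -> sigma z \in Aint.
Proof.
move=> /(integral_rmorph sigma)[p mp rp]; apply: root_monic_Aint rp _ _.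
  exact: monic_map mp.
apply/polyOverP => i; rewrite coef_map /= rmorph_int; exact: intr_int.
Qed.

Definition quad_elt (x y : int) : K := x%:~R + y%:~R * quad_root.

Lemma quad_elt_alg_integer x y : alg_integer (quad_elt x y).
Proof.
have int_intr (n : int) : alg_integer (n%:~R : K) by exact: integral_id.
apply: integral_add (int_intr x) (integral_mul (int_intr y) _).
apply: (@integral_root_monic _ _ _ _ ('X^2 - D%:~R%:P)).
- by rewrite monicXnsubC.
- by rewrite rootE !hornerE quad_root_sqr subrr.
apply/integral_poly => i; rewrite coefB coefXn coefC.
apply: integral_sub; first by case: eqP => _; [exact: integral1|exact: integral0].
by case: ifP => _; [exact: int_intr|exact: integral0].
Qed.

(** If a + b sqrt D is integral then so are its trace 2 a and its norm
    a^2 - D b^2.  As D is square-free, 2 b is an integer too, and as D = 2 mod 4,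
    the congruence (2 a)^2 = D (2 b)^2 mod 4 forces both to be even. *)
Lemma alg_integer_quad_elt z :
  (D %% 4 = 2)%Z -> alg_integer z -> exists x y, z = quad_elt x y.
Proof.
move=> D2 z_int; have [a [b zE]] := quad_coord z.
have [s sr] := quad_embedding (sqrtCK D%:~R : rt ^+ 2 = D%:~R).
have [|s' s'r] := @quad_embedding _ (- rt); first by rewrite sqrrN sqrtCK.
have := alg_integer_Aint s z_int; have := alg_integer_Aint s' z_int.
rewrite zE !embedding_coord sr s'r => Az' Az.
have rat_int (q : rat) : ratr q \in Aint -> exists n : int, q = n%:~R.
  move=> /(Cint_rat_Aint (Crat_rat q)) /intrP[n]; rewrite -(ratr_int algC).
  by move/fmorph_inj => ->; exists n.
have [|A AE] := @rat_int (2 * a).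
  rewrite (_ : ratr _ = (ratr a + ratr b * rt) + (ratr a + ratr b * - rt)); first exact: rpredD.
  by rewrite rmorphM /= ratr_nat; ring.
have [|N NE] := @rat_int (a ^+ 2 - D%:~R * b ^+ 2).
  rewrite (_ : ratr _ = (ratr a + ratr b * rt) * (ratr a + ratr b * - rt)); first exact: rpredM.
  rewrite rmorphB rmorphM !rmorphXn /= ratr_int -(sqrtCK D%:~R) -/rt; ring.
have [|B BE] := @squarefree_mul_sqr_int D (2 * b) (A ^+ 2 - 4 * N) sqfD.
  by rewrite rmorphB rmorphXn rmorphM /= -AE -NE; ring.
have e4 : A ^+ 2 - D * B ^+ 2 = 4 * N.
  apply/eqP; rewrite -(eqr_int rat) rmorphB !rmorphM /= -AE -BE -NE.
  by apply/eqP; ring.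
have [x [y [Ax By]]] : exists x y, A = 2 * x /\ B = 2 * y.
  exists (A %/ 2)%Z, (B %/ 2)%Z.
  have := divz_eq D 4; rewrite D2; move: (D %/ 4)%Z => d DE.
  have := divz_eq A 2; have := divz_eq B 2.
  move: e4 (modz_ge0 A (isT : 2 != 0 :> int)) (ltz_pmod A (isT : 0 < 2 :> int)).
  move: (modz_ge0 B (isT : 2 != 0 :> int)) (ltz_pmod B (isT : 0 < 2 :> int)).
  move: (A %/ 2)%Z (B %/ 2)%Z (A %% 2)%Z (B %% 2)%Z => x y al be.
  move=> b0 b1 + a0 a1 AE2 BE2; rewrite DE AE2 BE2 => e5.
  have [al0|al0] : al = 0 \/ al = 1 by lia.
    have [be0|be0] : be = 0 \/ be = 1 by lia.
      by rewrite al0 be0; split; lia.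
    by rewrite al0 be0 in e5; lia.
  have [be0|be0] : be = 0 \/ be = 1 by lia.
    by rewrite al0 be0 in e5; lia.
  by rewrite al0 be0 in e5; lia.
exists x, y; rewrite /quad_elt -mul_polyC rmorphD rmorphM -/quad_root.
have -> : a = x%:~R.
  by apply: (mulfI (_ : 2 != 0)) => //; rewrite AE Ax rmorphM.
have -> : b = y%:~R.
  by apply: (mulfI (_ : 2 != 0)) => //; rewrite BE By rmorphM.
by congr (_ + _ * _); exact: (rmorph_int (quad_eval \o polyC)).
Qed.

End QuadraticField.

(** * Binary forms over a field *)

Lemma det_gram (K : fieldType) (Q : bqf K) :
  bqf_det Q = qa Q * qc Q - (qb Q / 2) ^+ 2.
Proof.
rewrite /bqf_det (expand_det_row _ 0) !big_ord_recl big_ord0 /cofactor.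
rewrite !det_mx11 !mxE /= expr0 expr1. ring.
Qed.

Lemma gram_congruence_qa (K : fieldType) (Q H : bqf K) (N : 'M[K]_2) :
  2 != 0 :> K -> gram H = N *m gram Q *m N^T ->
  qa H = bqf_eval Q (N 0 0) (N 0 1).
Proof.
move=> K2 /matrixP/(_ 0 0); rewrite !mxE /= !big_ord_recl !big_ord0 /=.
rewrite !mxE /= !big_ord_recl !big_ord0 /= !mxE /= !addr0 => ->.
have -> : lift 0 0 = 1 :> 'I_2 by exact: val_inj.
by rewrite /bqf_eval; field.
Qed.

(** The inverse of an integral matrix with unit determinant is its adjugate
    times the inverse of the determinant, hence integral. *)
Lemma bqf_equiv_sym (K : fieldType) (Q H : bqf K) : bqf_equiv Q H -> bqf_equiv H Q.
Proof.
move=> [N [N_int [N_det [e [e_int Ne]]] HE]].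
have NV : (e *: \adj N) *m N = 1%:M.
  by rewrite -scalemxAl mul_adj_mx scale_scalar_mx mulrC Ne.
have sgn_int (k : nat) : alg_integer ((-1) ^+ k : K).
  rewrite -signr_odd; case: odd; last exact: integral1.
  by apply: integral_opp; exact: integral1.
exists (e *: \adj N); split.
- move=> i j; rewrite !mxE /cofactor det_mx11 !mxE.
  by apply: integral_mul e_int (integral_mul (sgn_int _) (N_int _ _)).
- have dE : \det (e *: \adj N) = e.
    apply: (mulIf (_ : \det N != 0)).
      by apply/eqP => N0; move: Ne; rewrite N0 mul0r => /esym/eqP; rewrite oner_eq0.
    by rewrite -det_mulmx NV det1 mulrC Ne.
  by rewrite dE; split=> //; exists (\det N); rewrite mulrC.
by rewrite HE !mulmxA NV mul1mx -mulmxA -trmx_mul NV trmx1 mulmx1.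
Qed.

(** * Indecomposable forms over Z[sqrt (t^2 + 1)] *)

Lemma sqr_add1_mod4 (t : int) : (t %% 2 = 1)%Z -> ((t ^+ 2 + 1) %% 4 = 2)%Z.
Proof.
move=> t_odd; have := divz_eq t 2; rewrite t_odd; move: (t %/ 2)%Z => h tE.
rewrite (_ : _ + 1 = (h ^+ 2 + h) * 4 + 2); last by rewrite tE; ring.
by rewrite modzMDl.
Qed.

Section QuadraticForms.

Variables (R : realType) (t : int).
Let D : int := t ^+ 2 + 1.
Hypotheses (t_gt0 : 0 < t) (sqfD : squarefree D).
Local Notation K := (quadratic_field D).
Local Notation elt := (@quad_elt D).

Let D_gt1 : 1 < D.
Proof. by rewrite /D ltrDr exprn_gt0. Qed.

Lemma conjugate_embeddings (F : numFieldType) (r : F) : r ^+ 2 = D%:~R ->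
  exists s1 s2 : {rmorphism K -> F}, forall x y,
    s1 (elt x y) = x%:~R + y%:~R * r /\ s2 (elt x y) = x%:~R - y%:~R * r.
Proof.
move=> rD; have [s1 s1r] := quad_embedding D_gt1 sqfD rD.
have [|s2 s2r] := @quad_embedding _ D_gt1 sqfD _ (- r); first by rewrite sqrrN.
by exists s1, s2 => x y; rewrite !rmorphD !rmorphM !rmorph_int s1r s2r mulrN.
Qed.

Lemma sqrt_D : (Num.sqrt D%:~R : R) ^+ 2 = D%:~R.
Proof. by rewrite sqr_sqrtr // ler0z ltW // (lt_trans _ D_gt1). Qed.

Lemma quad_elt_inj x y u v : elt x y = elt u v -> x = u /\ y = v.
Proof.
move=> e; have [s1 [s2 sE]] := conjugate_embeddings (sqrtCK (D%:~R : algC)).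
have [e1 e2] := sE x y; rewrite e in e1 e2.
have [f1 f2] := sE u v; rewrite f1 in e1; rewrite f2 in e2.
have r0 : sqrtC D%:~R != 0 :> algC by rewrite sqrtC_eq0 intr_eq0; lia.
have xu : x = u.
  apply/eqP; rewrite -(eqr_int algC); apply/eqP.
  apply: (mulfI (_ : 2 != 0)); first by rewrite pnatr_eq0.
  transitivity ((x%:~R + y%:~R * sqrtC D%:~R) +
    (x%:~R - y%:~R * sqrtC D%:~R) : algC); first by ring.
  by rewrite -e1 -e2; ring.
split=> //; apply/eqP; rewrite -(eqr_int algC); apply/eqP; apply: (mulIf r0).
by move: e1; rewrite xu => /addrI.
Qed.

Lemma quad_elt_mul x y u v :
  elt x y * elt u v = elt (x * u + D * y * v) (x * v + y * u).
Proof.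
by rewrite /quad_elt !rmorphD !rmorphM /= -quad_root_sqr; ring.
Qed.

Lemma quad_elt_add x y u v : elt x y + elt u v = elt (x + u) (y + v).
Proof. by rewrite /quad_elt !rmorphD /=; ring. Qed.

Lemma totally_nonneg_quad_elt x y : totally_nonneg R (elt x y) ->
  0 <= x /\ D * y ^+ 2 <= x ^+ 2.
Proof.
have [s1 [s2 sE]] := conjugate_embeddings sqrt_D.
have [e1 e2] := sE x y; move=> nn; have := nn s1; have := nn s2.
rewrite {}e1 {}e2; set r := Num.sqrt _ => h2 h1; split.
  by rewrite -(ler0z R); lra.
rewrite -(ler_int R) rmorphM !rmorphXn /= -sqrt_D -subr_ge0 -/r.
by have := mulr_ge0 h1 h2; congr (_ <= _); ring.
Qed.

Lemma embedding_quad_elt_gt0 (F : realFieldType) (s : {rmorphism K -> F}) x y :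
  0 < x -> D * y ^+ 2 < x ^+ 2 -> 0 < s (elt x y).
Proof.
have sD : s (quad_root D) ^+ 2 = D%:~R by apply: embedding_root_sqr.
rewrite -(ltr0z F) -(ltr_int F) rmorphM !rmorphXn /= -sD => x0 xy.
rewrite rmorphD rmorphM !rmorph_int; move: xy x0; set r := s _.
move: (x%:~R) (y%:~R) => a b ab a0; rewrite ltNge; apply/negP => ab'.
have : (a + b * r) * (a - b * r) <= 0 by apply: mulr_le0_ge0; nra.
nra.
Qed.

(** From x <= t y and x >= 0 one gets D y^2 <= x^2 <= t^2 y^2 < D y^2 unless
    y = 0. *)
Lemma totally_nonneg_functional x y :
  totally_nonneg R (elt x y) -> x - t * y <= 0 -> elt x y = 0.
Proof.
move=> /totally_nonneg_quad_elt[x0 xy] l0.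
have y0 : y = 0.
  apply/eqP; rewrite -sqrf_eq0 eq_le sqr_ge0 andbT.
  have : x ^+ 2 <= (t * y) ^+ 2 by rewrite ler_sqr ?nnegrE; lia.
  move: xy; rewrite /D; lia.
have -> : x = 0 by move: l0; rewrite y0; lia.
by rewrite y0 /quad_elt mul0r addr0.
Qed.

Lemma quad_two_neq0 : 2 != 0 :> K.
Proof.
have [s _] := conjugate_embeddings sqrt_D.
by rewrite -(fmorph_eq0 s) rmorph_nat pnatr_eq0.
Qed.

Hypothesis t_odd : (t %% 2 = 1)%Z.

Let D_mod4 := sqr_add1_mod4 t_odd.

Lemma functional_one_indecomposable x y (a1 a2 : K) :
  x - t * y = 1 -> alg_integer a1 -> alg_integer a2 ->
  totally_nonneg R a1 -> totally_nonneg R a2 -> elt x y = a1 + a2 ->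
  a1 = 0 \/ a2 = 0.
Proof.
move=> l1 /(alg_integer_quad_elt D_gt1 sqfD D_mod4)[x1 [y1 ->]].
move=> /(alg_integer_quad_elt D_gt1 sqfD D_mod4)[x2 [y2 ->]] nn1 nn2.
rewrite quad_elt_add => /quad_elt_inj[xE yE].
have [l0|l0] := lerP (x1 - t * y1) 0; [left|right]; apply: totally_nonneg_functional => //.
by move: l1; rewrite xE yE mulrDr; lia.
Qed.

(** Otherwise the form b x y + c y^2 takes the value -1 at
    (- (c + 1) / b, 1). *)
Lemma totally_psd_qa0 (Q : bqf K) : totally_psd R Q -> qa Q = 0 -> qb Q = 0.
Proof.
move=> psd a0; apply/eqP/negPn/negP => b0.
have [s _] := conjugate_embeddings sqrt_D.
have := psd (- (qc Q + 1) / qb Q) 1 s.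
rewrite /bqf_eval a0 mul0r add0r expr1n !mulr1 mulrC divfK // opprD addrAC addNr add0r.
by rewrite rmorphN rmorph1; lra.
Qed.

(** This is the value of the form at (- b / 2, a). *)
Lemma totally_psd_det (Q : bqf K) :
  totally_psd R Q -> totally_nonneg R (qa Q * bqf_det Q).
Proof.
move=> psd s; have := psd (- qb Q / 2) (qa Q) s.
rewrite (_ : bqf_eval _ _ _ = qa Q * bqf_det Q) // det_gram /bqf_eval.
by field; exact: quad_two_neq0.
Qed.

(** The functional x - t y forces one summand to be c' y^2; comparing a c' with
    d at both embeddings then bounds N(a) by d^2. *)
Lemma additively_indecomposable_of_norm (Q : bqf K) (x y : int) (d : nat) :
  qa Q = elt x y -> x - t * y = 1 -> 0 < x -> d%:Z ^+ 2 < x ^+ 2 - D * y ^+ 2 ->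
  bqf_det Q = d%:R -> additively_indecomposable R Q.
Proof.
move=> aE l1 x0 dN detQ [Q1 [Q2 [[int1 psd1 nz1] [[int2 psd2 nz2] QE]]]].
have qa_nn (H : bqf K) : totally_psd R H -> totally_nonneg R (qa H).
  by move=> psd; have := psd 1 0; rewrite /bqf_eval !expr1n expr0n /= !mulr0 !addr0 mulr1.
have : qa Q1 = 0 \/ qa Q2 = 0.
  case: int1 int2 => [i1 _ _] [i2 _ _].
  by apply: (functional_one_indecomposable l1) => //; try exact: qa_nn; rewrite -aE QE.
wlog a0 : Q1 Q2 int1 psd1 nz1 int2 psd2 nz2 QE / qa Q1 = 0.
  move=> W [a0|a0]; first by apply: (W Q1 Q2) => //; left.
  apply: (W Q2 Q1) => //; last by left.
  by rewrite QE /bqf_add [qa Q1 + _]addrC [qb Q1 + _]addrC [qc Q1 + _]addrC.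
move=> _; have b0 := totally_psd_qa0 psd1 a0.
have c_nn : totally_nonneg R (qc Q1).
  by have := psd1 0 1; rewrite /bqf_eval !expr1n expr0n /= !mulr0 mul0r !add0r ?mulr0 ?mulr1 ?add0r.
have c0 : qc Q1 != 0.
  apply/eqP => c0; apply: nz1; move: a0 b0 c0; case: (Q1) => a b c /= -> -> ->.
  by [].
have a2E : qa Q2 = elt x y by rewrite -aE QE /= a0 add0r.
have det2 : bqf_det Q2 = d%:R - elt x y * qc Q1.
  rewrite -detQ !det_gram QE /= a0 b0 !add0r -a2E; ring.
have [u [v cE]] : exists u v, qc Q1 = elt u v.
  by apply: (alg_integer_quad_elt D_gt1 sqfD D_mod4); case: int1.
have [s1 [s2 sE]] := conjugate_embeddings sqrt_D.
have bound (s : {rmorphism K -> R}) : s (elt x y) * s (elt u v) <= d%:R :> R.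
  have := totally_psd_det psd2 s; rewrite a2E det2 rmorphM rmorphB rmorph_nat.
  rewrite rmorphM -cE pmulr_rge0 ?subr_ge0 //.
  apply: embedding_quad_elt_gt0 => //; nia.
have cpos (s : {rmorphism K -> R}) : 0 < s (elt u v) :> R.
  by rewrite lt_neqAle eq_sym fmorph_eq0 -cE c0 c_nn.
have apos (s : {rmorphism K -> R}) : 0 < s (elt x y) :> R.
  by apply: embedding_quad_elt_gt0 => //; nia.
have normE p q : s1 (elt p q) * s2 (elt p q) = (p ^+ 2 - D * q ^+ 2)%:~R :> R.
  have [-> ->] := sE p q.
  have := sqrt_D; set r := Num.sqrt _ => rD.
  by rewrite rmorphB !rmorphM /= -rD; ring.
have N1 : 1 <= u ^+ 2 - D * v ^+ 2.
  by rewrite -gtz0_ge1 -(ltr0z R) -normE mulr_gt0.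
have : (x ^+ 2 - D * y ^+ 2) * (u ^+ 2 - D * v ^+ 2) <= d%:Z ^+ 2.
  rewrite -(ler_int R) rmorphM rmorphXn /= -!normE mulrACA expr2.
  by rewrite ler_pM // ltW // mulr_gt0.
apply/negP; rewrite -ltNge (lt_le_trans dN) // ler_peMr //.
by rewrite ltW // (le_lt_trans (sqr_ge0 _) dN).
Qed.

(** Completing the square, a Q(x, y) = (a x + b y / 2)^2 + d y^2. *)
Lemma totally_pd_of_det (Q : bqf K) (d : nat) :
  (forall s : {rmorphism K -> R}, 0 < s (qa Q)) -> (0 < d)%N ->
  bqf_det Q = d%:R -> totally_pd R Q.
Proof.
move=> apos d0 detQ.
have sq x y : qa Q * bqf_eval Q x y =
    (qa Q * x + qb Q / 2 * y) ^+ 2 + d%:R * y ^+ 2.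
  rewrite -detQ det_gram /bqf_eval; field.
  exact: quad_two_neq0.
split=> [x y s|x y Q0].
  rewrite -(pmulr_rge0 _ (apos s)) -rmorphM sq rmorphD rmorphM !rmorphXn rmorph_nat.
  by rewrite addr_ge0 ?sqr_ge0 // mulr_ge0 ?sqr_ge0.
have [s _] := conjugate_embeddings sqrt_D.
have := congr1 s (sq x y); rewrite Q0 mulr0 rmorph0 rmorphD rmorphM !rmorphXn rmorph_nat.
move=> /esym/eqP; rewrite paddr_eq0 ?sqr_ge0 ?(mulr_ge0 (ler0n _ _) (sqr_ge0 _)) //.
rewrite [X in _ && X]mulf_eq0 pnatr_eq0 -leqn0 leqNgt d0 /= !sqrf_eq0 !fmorph_eq0.
move=> /andP[+ /eqP y0]; rewrite y0 mulr0 addr0 mulf_eq0 => /orP[/eqP a0|/eqP //].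
by have := apos s; rewrite a0 rmorph0 ltxx.
Qed.

End QuadraticForms.

(** * The family of forms attached to Pythagorean triples *)

Section Family.

Variables (R : realType) (t : int).
Let D : int := t ^+ 2 + 1.
Hypotheses (t_gt0 : 0 < t) (sqfD : squarefree D) (t_odd : (t %% 2 = 1)%Z).
Local Notation K := (quadratic_field D).
Local Notation elt := (@quad_elt D).

Let D_gt1 : 1 < D.
Proof. by rewrite /D ltrDr exprn_gt0. Qed.

(** The first coefficient is (t + sqrt D) (z + sqrt D), an element of norm
    D - z^2; the last one is m^2 times its conjugate. *)
Definition family_form (m z w : int) : bqf (quadratic_field D) :=
  BQF (elt (D + t * z) (t + z)) (elt (2 * m * w) 0)
      (elt (m ^+ 2 * (D + t * z)) (- (m ^+ 2 * (t + z)))).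

Variables (m : nat) (z w : int).
Hypotheses (z_ge0 : 0 <= z) (zw : t ^+ 2 = z ^+ 2 + w ^+ 2).

Lemma family_norm : (D + t * z) ^+ 2 - D * (t + z) ^+ 2 = w ^+ 2 + 1.
Proof.
have -> : w ^+ 2 = t ^+ 2 - z ^+ 2 by rewrite zw; ring.
by rewrite /D; ring.
Qed.

Lemma family_qa_gt0 : 0 < D + t * z.
Proof.
by rewrite (lt_le_trans (lt_trans ltr01 D_gt1)) // lerDl mulr_ge0 // ltW.
Qed.

Lemma family_det : bqf_det (family_form m z w) = (m ^ 2)%:R.
Proof.
have -> : (m ^ 2)%:R = elt (m%:Z ^+ 2) 0.
  by rewrite /quad_elt mul0r addr0 rmorphXn natrX.
rewrite det_gram /=.
have -> : elt (2 * m%:Z * w) 0 / 2 = elt (m%:Z * w) 0.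
  apply: (mulIf (quad_two_neq0 R t_gt0 sqfD)); rewrite divfK ?quad_two_neq0 //.
  by rewrite /quad_elt !mul0r !addr0 !rmorphM /=; ring.
apply/eqP; rewrite subr_eq [elt _ _ ^+ 2]expr2 !quad_elt_mul quad_elt_add; apply/eqP.
congr quad_elt; last by ring.
transitivity (m%:Z ^+ 2 * ((D + t * z) ^+ 2 - D * (t + z) ^+ 2)); first by rewrite /D; ring.
by rewrite family_norm; ring.
Qed.

(** Modulo m the form reduces to a x^2, whose norm is N(a) N(x)^2. *)
Lemma family_eval_norm (x1 x2 y1 y2 p q : int) :
  elt p q = bqf_eval (family_form m z w) (elt x1 x2) (elt y1 y2) ->
  exists k : int, p ^+ 2 - D * q ^+ 2 =
    (w ^+ 2 + 1) * (x1 ^+ 2 - D * x2 ^+ 2) ^+ 2 + m%:Z * k.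
Proof.
rewrite /bqf_eval /= ![elt _ _ ^+ 2]expr2 !quad_elt_mul !quad_elt_add.
move=> /(quad_elt_inj t_gt0 sqfD)[-> ->]; rewrite -!expr2 -family_norm.
set X := D + t * z; set Y := t + z; rewrite -/D.
(* x^2 = xx1 + xx2 sqrt D and a x^2 = P1 + P2 sqrt D; the remaining terms of the
   value are m (e1 + e2 sqrt D). *)
pose xx1 := x1 ^+ 2 + D * x2 ^+ 2; pose xx2 := 2 * x1 * x2.
pose P1 := X * xx1 + D * Y * xx2; pose P2 := X * xx2 + Y * xx1.
pose e1 := 2 * w * (x1 * y1 + D * x2 * y2)
  + m%:Z * (X * (y1 ^+ 2 + D * y2 ^+ 2) - D * Y * (2 * y1 * y2)).
pose e2 := 2 * w * (x1 * y2 + x2 * y1)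
  + m%:Z * (X * (2 * y1 * y2) - Y * (y1 ^+ 2 + D * y2 ^+ 2)).
exists (2 * P1 * e1 + m%:Z * e1 ^+ 2 - D * (2 * P2 * e2 + m%:Z * e2 ^+ 2)).
by rewrite /e1 /e2 /P1 /P2 /xx1 /xx2; ring.
Qed.

Lemma family_indecomposable : (m%:Z ^+ 4 < w ^+ 2 + 1) ->
  additively_indecomposable R (family_form m z w).
Proof.
move=> mw; apply: (@additively_indecomposable_of_norm R t _ _ _ _ (D + t * z) (t + z) (m ^ 2)) => //.
- by rewrite /D; ring.
- exact: family_qa_gt0.
- by rewrite family_norm -mulnn PoszM -expr2 -exprM.
- exact: family_det.
Qed.

Lemma family_pd : (0 < m)%N -> totally_pd R (family_form m z w).
Proof.
move=> m0; apply: (@totally_pd_of_det R t _ _ _ (m ^ 2)) => //.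
- move=> s; apply: embedding_quad_elt_gt0.
    exact: family_qa_gt0.
  by rewrite -subr_gt0 family_norm ltr_wpDl ?sqr_ge0.
- by rewrite expn_gt0 m0.
- exact: family_det.
Qed.

Lemma family_integral : integral_form (family_form m z w).
Proof. by split; apply: quad_elt_alg_integer. Qed.

End Family.

(** The first coefficient of the second form, of norm w'^2 + 1, is a value of
    the first one. *)
Lemma family_equiv_dvd (R : realType) (t : int) (m : nat) (z w z' w' : int) :
  0 < t -> squarefree (t ^+ 2 + 1) -> (t %% 2 = 1)%Z ->
  t ^+ 2 = z ^+ 2 + w ^+ 2 -> t ^+ 2 = z' ^+ 2 + w' ^+ 2 ->
  bqf_equiv (family_form t m z w) (family_form t m z' w') ->
  (gcdz m (w ^+ 2 + 1) %| gcdz m (w' ^+ 2 + 1))%Z.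
Proof.
move=> t0 sqf todd zw zw' [N [N_int _ /gram_congruence_qa aE]].
have D_gt1 : 1 < t ^+ 2 + 1 by rewrite ltrDr exprn_gt0.
have D_mod4 := sqr_add1_mod4 todd.
have [x1 [x2 Nx]] := alg_integer_quad_elt D_gt1 sqf D_mod4 (N_int 0 0).
have [y1 [y2 Ny]] := alg_integer_quad_elt D_gt1 sqf D_mod4 (N_int 0 1).
have := aE (quad_two_neq0 R t0 sqf); rewrite Nx Ny.
move=> /(family_eval_norm t0 sqf zw)[k kE].
by rewrite dvdz_gcd dvdz_gcdl /= -(family_norm zw') kE rpredD // dvdz_mulr ?dvdz_gcdl ?dvdz_gcdr //.
Qed.

Lemma squarefree_sqr_add1 (t : nat) :
  (forall p, prime p -> ~~ (p ^ 2 %| t ^ 2 + 1)%N) -> squarefree (t%:Z ^+ 2 + 1).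
Proof.
move=> sqf x; rewrite dvdzE => x2.
have {}x2 : (`|x| ^ 2 %| t ^ 2 + 1)%N.
  by move: x2; rewrite abszX expr2 -PoszM -PoszD absz_nat mulnn.
suff : `|x|%N = 1%N by rewrite qualifE /=; lia.
apply/eqP/negPn/negP => x1.
have x0 : (0 < `|x|)%N.
  by rewrite lt0n; apply: contraL x2 => /eqP->; rewrite exp0n // dvd0n addn1.
have pp : prime (pdiv `|x|) by rewrite pdiv_prime // ltn_neqAle eq_sym x1.
move/negP: (sqf _ pp); apply; apply: dvdn_trans x2.
by rewrite dvdn_exp2r ?pdiv_dvd.
Qed.

Theorem theorem1p5 (R : realType) (n : nat) :
  exists (D : int) (d : nat),
    [/\ 1 < D, squarefree D & (0 < d)%N] /\
    exists F : 'I_n -> bqf (quadratic_field D),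
      (forall i : 'I_n,
         [/\ integral_form (F i),
             totally_pd R (F i),
             additively_indecomposable R (F i)
           & bqf_det (F i) = d%:R]) /\
      (forall i j : 'I_n, i <> j -> ~ bqf_equiv (F i) (F j)).
Proof.
have [t [m [z [w [[t_odd m_gt0 t_sqf] tzw mw inj_gcd]]]]] := exists_parameters n.
have t_gt0 : 0 < t%:Z by have := odd_gt0 t_odd; lia.
have sqfD := squarefree_sqr_add1 t_sqf.
have t_mod2 : (t%:Z %% 2 = 1)%Z by rewrite modz_nat modn2 t_odd.
have zwZ i : t%:Z ^+ 2 = (z i)%:Z ^+ 2 + (w i)%:Z ^+ 2.
  by rewrite !expr2 -!PoszM -PoszD !mulnn -tzw.
exists (t%:Z ^+ 2 + 1), (m ^ 2)%N; split.
  by split=> //; [rewrite ltrDr exprn_gt0 | rewrite expn_gt0 m_gt0].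
exists (fun i => family_form t m (z i) (w i)); split=> [i|i j neq_ij].
  split.
  - exact: family_integral.
  - exact: family_pd.
  - apply: family_indecomposable => //; have := mw i; lia.
  - exact: (family_det R).
move=> eq_ij; apply: neq_ij; apply: inj_gcd => /=.
have eq_ji := bqf_equiv_sym eq_ij.
have gcdE l : gcdz m ((w l)%:Z ^+ 2 + 1) = gcdn m (w l ^ 2 + 1).
  by rewrite expr2 -PoszM mulnn.
apply/eqP; rewrite eqn_dvd.
have := family_equiv_dvd R t_gt0 sqfD t_mod2 (zwZ i) (zwZ j) eq_ij.
have := family_equiv_dvd R t_gt0 sqfD t_mod2 (zwZ j) (zwZ i) eq_ji.
by rewrite !gcdE !dvdzE /= => -> ->.
Qed.
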